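(* (1) Let $3\le t\le 9$ and let $p,q$ be distinct primes with $p,q\le 19$. Then every solution in non-negative integers $\alpha_1,\dots,\alpha_t$ of $$1+p^{\alpha_1}+\dots+p^{\alpha_{t-1}}-q^{\alpha_t}=0$$ satisfies $\min_{1\le i\le t}\alpha_i\le 6$. (2) The equation $$1+5^{\alpha_1}+5^{\alpha_2}+5^{\alpha_3}+5^{\alpha_4}+5^{\alpha_5}+5^{\alpha_6}+5^{\alpha_7}+5^{\alpha_8}-17^{\alpha_9}=0$$ has exactly two solutions in non-negative integers $\alpha_1,\dots,\alpha_9$ with $\alpha_1\le\alpha_2\le\dots\le\alpha_8$, namely $(\alpha_1,\dots,\alpha_9)=(0,0,0,0,0,0,1,1,1)$ and $(0,0,0,1,1,2,3,3,2)$. *)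

(* Defs.v *)
From mathcomp Require Export all_boot.
Set Implicit Arguments.
Unset Strict Implicit.
Unset Printing Implicit Defensive.

(* Main.v *)
Require Import Defs.
From mathcomp Require Import all_boot.
From Stdlib Require Import NArith Lia.

(* Fix a and n > 0 and let M = p^a (p^n - 1). Modulo M every power of p is
   congruent to one with exponent below a + n, so a sum S of k powers of p is
   congruent to a sum S' <= k p^(a+n-1) of k such powers. The base p digit sum
   w of S' satisfies w <= k and w = k mod p - 1. If 1 + S = q^b, then also
   S' = q^b - 1 mod M, and this takes finitely many values as b varies; for
   suitable a and n, hardly any of the candidates for S' below the bound has
   such a digit sum (and, when all exponents are at least lo, is divisible by
   p^min(lo, a)). The classes of b that survive are split into classes for
   another M and tested again. For the equation with 5 and 17 the only
   candidates left are S' = 16 and S' = 288; being less than 5^a, they force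
   S = S'. *)

Set Implicit Arguments.
Unset Strict Implicit.
Unset Printing Implicit Defensive.

Local Open Scope N_scope.

(** * Sums of powers and base p digit sums *)

Fixpoint sum_pow (p : N) (xs : seq N) : N :=
  if xs is x :: xs' then p ^ x + sum_pow p xs' else 0.

(** The fuel [f] is the number of digits read. The upper bound on the digit sum holds for any fuel;
    only the congruence modulo p - 1 needs all digits. *)
Fixpoint digit_sum (f : nat) (p m : N) : N :=
  if f is f'.+1 then m mod p + digit_sum f' p (m / p) else 0.

Lemma digit_sum0 f p : 1 < p -> digit_sum f p 0 = 0.
Proof.
by move=> p1; elim: f => //= f IH; rewrite N.Div0.mod_0_l N.Div0.div_0_l IH.
Qed.

(** Adding p^x raises one digit by 1, and each carry turns a digit p - 1 into 0, which only lowers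
    the sum. *)
Lemma digit_sum_add_pow f p m x :
  1 < p -> digit_sum f p (m + p ^ x) <= digit_sum f p m + 1.
Proof.
move=> p1; elim: f m x => [|f IH] m x /=; first by lia.
have p0 : p <> 0 by lia.
have [x0|x0] := N.eq_dec x 0.
  rewrite {}x0 N.pow_0_r.
  have dm := N.div_mod' m p; have lm := N.mod_lt m p p0.
  have [lt1|ge1] := N.lt_ge_cases (m mod p + 1) p.
    rewrite -(N.div_unique (m + 1) p (m / p) (m mod p + 1)); try lia.
    rewrite -(N.mod_unique (m + 1) p (m / p) (m mod p + 1)); lia.
  rewrite -(N.div_unique (m + 1) p (m / p + 1) 0); try lia.
  rewrite -(N.mod_unique (m + 1) p (m / p + 1) 0); try lia.
  by have := IH (m / p) 0; rewrite N.pow_0_r; lia.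
have -> : x = N.succ (N.pred x) by lia.
rewrite N.pow_succ_r' (N.mul_comm p) N.Div0.mod_add N.div_add //.
by have := IH (m / p) (N.pred x); lia.
Qed.

Lemma digit_sum_sum_pow f p xs :
  1 < p -> digit_sum f p (sum_pow p xs) <= N.of_nat (size xs).
Proof.
move=> p1; elim: xs => [|x xs IH] /=; first by rewrite digit_sum0.
by rewrite N.add_comm; have := @digit_sum_add_pow f p (sum_pow p xs) x p1; lia.
Qed.

Lemma digit_sum_mod f p m :
  1 < p -> m < p ^ N.of_nat f -> exists c, m = digit_sum f p m + c * (p - 1).
Proof.
move=> p1; elim: f m => [|f IH] m; first by move=> /= ?; exists 0; lia.
rewrite Nat2N.inj_succ N.pow_succ_r' => mlt; have p0 : p <> 0 by lia.
have [|c Hc] := IH (m / p).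
  exact: N.Div0.div_lt_upper_bound.
by exists (c + m / p); have := N.div_mod' m p; rewrite /=; nia.
Qed.

Lemma sum_pow_mod p xs :
  1 < p -> exists c, sum_pow p xs = N.of_nat (size xs) + c * (p - 1).
Proof.
move=> p1; elim: xs => [|x xs [c IH]]; first by exists 0.
have [d Hd] : exists d, p ^ x = 1 + d * (p - 1).
  elim/N.peano_ind: x => [|x [d Hd]]; first by exists 0.
  by exists (d * p + 1); rewrite N.pow_succ_r' Hd; nia.
by exists (c + d); cbn [sum_pow size]; rewrite Hd IH; lia.
Qed.

Lemma sum_pow_gt0 p xs : 1 < p -> xs <> [::] -> 0 < sum_pow p xs.
Proof.
case: xs => // x xs p1 _ /=.
by have : p ^ x <> 0 by [apply: N.pow_nonzero; lia]; lia.
Qed.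

(** Necessary conditions for a number of digit sum w to be a sum of k powers of p. The subtraction
    is reached only when w <= k, so it does not truncate. *)
Definition fits (p w k : N) : bool :=
  if w <=? k then (k - w) mod (p - 1) =? 0 else false.

Lemma fits_sum_pow p xs S : 1 < p -> S = sum_pow p xs ->
  fits p (digit_sum (N.size_nat S) p S) (N.of_nat (size xs)).
Proof.
move=> p1 SE; rewrite /fits.
have := @digit_sum_sum_pow (N.size_nat S) p xs p1; rewrite -SE => wk.
have -> : digit_sum (N.size_nat S) p S <=? N.of_nat (size xs) by apply/N.leb_le.
(* As p >= 2, the binary length of S is enough fuel for its base p digits. *)
have [|c Hc] := digit_sum_mod (f := N.size_nat S) (m := S) p1.
  have : S < 2 ^ N.size S by exact: N.size_gt.
  have -> : N.size S = N.of_nat (N.size_nat S).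
    rewrite /N.size /N.size_nat; case: (S) => // s; elim: s => // s IH;
      by rewrite [Pos.size_nat _]/= Nat2N.inj_succ -IH.
  have : 2 ^ N.of_nat (N.size_nat S) <= p ^ N.of_nat (N.size_nat S).
    by apply: N.pow_le_mono_l; lia.
  lia.
have [d Hd] := sum_pow_mod xs p1.
have -> : N.of_nat (size xs) - digit_sum (N.size_nat S) p S = (c - d) * (p - 1).
  by rewrite -SE in Hd; nia.
by rewrite N.Div0.mod_mul.
Qed.

(** * Reducing exponents modulo p^a (p^n - 1) *)

Definition red (a n x : N) : N := if x <? a then x else a + (x - a) mod n.

Definition modulus (p a n : N) : N := p ^ a * (p ^ n - 1).

Lemma pow_gt0 p x : 1 < p -> 0 < p ^ x.
Proof. by move=> p1; have := @N.pow_nonzero p x; lia. Qed.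

Lemma modulus_gt0 p a n : 1 < p -> 0 < n -> 0 < modulus p a n.
Proof.
move=> p1 n0; have := pow_gt0 a p1; have := N.pow_gt_1 p n p1.
by rewrite /modulus; nia.
Qed.

(** For x = a + s + n u, the factor p^(n u) - 1 is a multiple of p^n - 1, and p^a completes the
    modulus. Reduction never increases the power, so the congruence is an equation with c >= 0. *)
Lemma pow_red p a n x : 1 < p -> 0 < n ->
  exists c, p ^ x = p ^ red a n x + c * modulus p a n.
Proof.
move=> p1 n0; rewrite /red; case: N.ltb_spec => [_|ax]; first by exists 0; lia.
have := N.div_mod' (x - a) n; move: ((x - a) mod n) ((x - a) / n) => s u xE.
have -> : x = a + s + n * u by lia.
rewrite !N.pow_add_r N.pow_mul_r /modulus.
have pn := pow_gt0 n p1; move: (p ^ n) pn => y y0.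
have [d ->] : exists d, y ^ u = 1 + d * (y - 1).
  elim/N.peano_ind: u {xE} => [|u [d Hd]]; first by exists 0.
  by exists (d * y + 1); rewrite N.pow_succ_r' Hd; nia.
by exists (p ^ s * d); lia.
Qed.

Lemma sum_pow_red p a n xs : 1 < p -> 0 < n ->
  exists c, sum_pow p xs = sum_pow p (map (red a n) xs) + c * modulus p a n.
Proof.
move=> p1 n0; elim: xs => [|x xs [c IH]] /=; first by exists 0.
by have [d ->] := pow_red a x p1 n0; exists (c + d); rewrite IH; lia.
Qed.

Lemma sum_pow_red_le p a n xs : 1 < p -> 0 < n ->
  sum_pow p (map (red a n) xs) <= N.of_nat (size xs) * p ^ (a + n - 1).
Proof.
move=> p1 n0; elim: xs => [|x xs IH]; first by [].
cbn [sum_pow size map].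
suff : p ^ red a n x <= p ^ (a + n - 1) by lia.
apply: N.pow_le_mono_r; first by lia.
rewrite /red; case: N.ltb_spec => ? //; first by lia.
by have := N.mod_lt (x - a) n; lia.
Qed.

(** An exponent x >= a would contribute at least p^a after reduction; so all exponents are below a,
    where [red] is the identity. *)
Lemma sum_pow_red_eq p a n xs : 1 < p ->
  sum_pow p (map (red a n) xs) < p ^ a ->
  sum_pow p xs = sum_pow p (map (red a n) xs).
Proof.
move=> p1; elim: xs => //= x xs IH lt_a.
rewrite IH; last by lia.
have : p ^ red a n x < p ^ a by lia.
rewrite /red; case: N.ltb_spec => // ax.
suff : p ^ a <= p ^ (a + (x - a) mod n) by lia.
by apply: N.pow_le_mono_r; [lia | apply: N.le_add_r].
Qed.

Lemma sum_pow_dvd p d xs : 1 < p ->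
  all (fun x => d <=? x) xs -> sum_pow p xs mod p ^ d = 0.
Proof.
move=> p1; elim: xs => [|x xs IH] /=; first by rewrite N.Div0.mod_0_l.
move=> /andP[/N.leb_le dx /IH Hs].
have -> : p ^ x = p ^ (x - d) * p ^ d by rewrite -N.pow_add_r; congr N.pow; lia.
by rewrite N.add_comm N.Div0.mod_add.
Qed.

Lemma red_ge a n lo x : lo <= x -> N.min lo a <= red a n x.
Proof.
by rewrite /red; case: N.ltb_spec; have := N.le_add_r a ((x - a) mod n); lia.
Qed.

(** * Modular exponentiation by repeated squaring *)

Fixpoint pos_pow_mod (M x : N) (e : positive) : N :=
  match e with
  | xH => x mod M
  | xO e' => pos_pow_mod M ((x * x) mod M) e'
  | xI e' => (x * pos_pow_mod M ((x * x) mod M) e') mod M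
  end.

Definition pow_mod (M x e : N) : N :=
  if e is N.pos e' then pos_pow_mod M x e' else 1 mod M.

Lemma mod_pow_mod M x e : (x mod M) ^ e mod M = x ^ e mod M.
Proof.
elim/N.peano_ind: e => [|e IH]; first by rewrite !N.pow_0_r.
by rewrite !N.pow_succ_r' N.Div0.mul_mod N.Div0.mod_mod IH -N.Div0.mul_mod.
Qed.

Lemma pow_modE M x e : pow_mod M x e = x ^ e mod M.
Proof.
case: e => // e; rewrite /pow_mod.
elim: e x => [e IH|e IH|] x; cbn [pos_pow_mod]; rewrite ?N.pow_1_r // IH.
  rewrite mod_pow_mod N.Div0.mul_mod_idemp_r -N.pow_2_r -N.pow_mul_r.
  by rewrite -N.pow_succ_r'; congr (x ^ _ mod M); lia.
by rewrite mod_pow_mod -N.pow_2_r -N.pow_mul_r.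
Qed.

(** * The sieve on exponents of q and its soundness *)

Section Check.

Variables (p q lo : N) (ks allowed : seq N).

(* The conditionals in this section replace boolean connectives, whose second
   argument call-by-value would always evaluate. *)
Definition excluded (d t : N) : bool :=
  if t =? 0 then true else
  if negb (t mod d =? 0) then true else
  let w := digit_sum (N.size_nat t) p t in
  if all (fun k => ~~ fits p w k) ks then true else t \in allowed.

(** Exhausted fuel gives [false] unless [bound] has been passed, so too little fuel can only make
    the test fail. *)
Fixpoint all_progression (P : N -> bool) (f : nat) (M bound t : N) : bool :=
  if bound <? t then true else
  if f is f'.+1 then
    if P t then all_progression P f' M bound (t + M) else false
  else false.

(** The closing test [r =? r0] certifies that the residues return to their start, so the claimed
    period need not be proved separately. *)
Fixpoint all_orbit (P : N -> N -> bool) (f : nat) (M g s e r r0 : N) : bool :=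
  if f is f'.+1 then
    if P e r then all_orbit P f' M g s (e + s) ((r * g) mod M) r0 else false
  else r =? r0.

(* [check st b s] treats the exponents of q in the progression b + s N. An
   entry (a, n, l) of st stands for the modulus p^a (p^n - 1), modulo which
   q^(b + s i) has period l in i. The bound is less than 10 M if all elements
   of ks are at most 8, hence the fuel of [all_progression]. *)
Fixpoint check (st : seq (N * N * N)) (b s : N) : bool :=
  if st is (a, n, l) :: st' then
    let M := modulus p a n in
    let d := p ^ N.min lo a in
    let bound := foldr N.max 0 ks * p ^ (a + n - 1) in
    let r0 := pow_mod M q b in
    let good r :=
      all_progression (excluded d) 10 M bound ((r + M - 1) mod M) in
    [&& 0 <? n, 0 <? l, all (fun t => t <? p ^ a) allowed &
      all_orbit (fun e r => if good r then true else check st' e (s * l))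
        (N.to_nat l) M (pow_mod M q s) s b r0 r0]
  else false.

Lemma all_progressionP P f M bound t j :
  all_progression P f M bound t -> t + j * M <= bound -> P (t + j * M).
Proof.
elim: f t j => [|f IH] t j /=; case: N.ltb_spec => tb; try by lia.
  by [].
case Pt : (P t) => // Pf.
have [->|j0] := N.eq_dec j 0; first by rewrite N.mul_0_l N.add_0_r.
have [k ->] : exists k, j = k + 1 by exists (j - 1); lia.
have -> : t + (k + 1) * M = t + M + k * M by lia.
exact: IH.
Qed.

Lemma all_orbitP P f M s e r0 :
  all_orbit P f M (q ^ s mod M) s e (q ^ e mod M) r0 ->
  q ^ (e + N.of_nat f * s) mod M = r0 /\
  (forall i, i < N.of_nat f -> P (e + i * s) (q ^ (e + i * s) mod M)).
Proof.
elim: f e => [|f IH] e.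
  by move=> /N.eqb_eq <-; split; [rewrite N.add_0_r | case].
rewrite Nat2N.inj_succ; cbn [all_orbit].
case Pe : (P e _) => //; rewrite -N.Div0.mul_mod -N.pow_add_r => /IH[eq_r0 Pi].
split; first by rewrite -eq_r0; congr (q ^ _ mod M); lia.
move=> i lt_i; have [->|i0] := N.eq_dec i 0.
  by rewrite N.mul_0_l N.add_0_r.
have [k iE] : exists k, i = k + 1 by exists (i - 1); lia.
have -> : e + i * s = e + s + k * s by rewrite iE; lia.
by apply: Pi; lia.
Qed.

Lemma max_ge k : k \in ks -> k <= foldr N.max 0 ks.
Proof.
elim: ks => //= x s IH; rewrite inE => /orP[/eqP->|/IH]; lia.
Qed.

Lemma check_sound st b s m xs :
  1 < p -> check st b s -> all (fun x => lo <=? x) xs ->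
  N.of_nat (size xs) \in ks -> xs <> [::] ->
  1 + sum_pow p xs = q ^ (b + m * s) -> sum_pow p xs \in allowed.
Proof.
move=> p1; elim: st b s m => [|[[a n] l] st IH] b s m //.
cbn [check]; rewrite !pow_modE.
case/and4P => /N.ltb_lt n0 /N.ltb_lt l0 alw orb lo_xs k_ks xs0 eqn.
have [per chk] := all_orbitP orb.
set M := modulus p a n in per chk.
have M0 : 0 < M by exact: modulus_gt0.
rewrite N2Nat.id in per chk.
have perE x u : q ^ (b + x + u * (l * s)) mod M = q ^ (b + x) mod M.
  elim/N.peano_ind: u => [|u IHu]; first by rewrite N.mul_0_l N.add_0_r.
  have -> : b + x + N.succ u * (l * s) = (b + l * s) + (x + u * (l * s)) by lia.
  rewrite N.pow_add_r N.Div0.mul_mod per -N.Div0.mul_mod -N.pow_add_r -IHu.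
  by congr (q ^ _ mod M); lia.
have dm := N.div_mod' m l; have ml := N.mod_lt m l.
have {}chk := chk (m mod l) ltac:(lia).
(* The exponent lies in the class of b + (m mod l) s modulo s l; this is the class handed to the
   next stage, with m / l as the new multiplier. *)
have bE : b + m * s = b + m mod l * s + m / l * (s * l) by nia.
set r := q ^ _ mod M in chk.
have rE : q ^ (b + m * s) mod M = r.
  by rewrite bE (N.mul_comm s) perE.
case: ifP chk => [good _|_ chk]; last first.
  by apply: (IH _ _ (m / l) chk); rewrite // eqn bE.
have [c Sc] := sum_pow_red a xs p1 n0; rewrite -/M in Sc.
set S' := sum_pow p (map (red a n) xs) in Sc.
(* The summand M keeps r - 1 from truncating when r = 0. Thus S' is the term of index S' / M in the
   progression tested. *)
have S'E : S' = (r + M - 1) mod M + S' / M * M.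
  suff -> : (r + M - 1) mod M = S' mod M by have := N.div_mod' S' M; lia.
  have := N.div_mod' (q ^ (b + m * s)) M; rewrite rE.
  move: (q ^ _ / M) => u rM.
  rewrite -(N.Div0.mod_add _ u) -(N.Div0.mod_add S' (c + 1)).
  by congr (_ mod M); lia.
have le_bound : S' <= foldr N.max 0 ks * p ^ (a + n - 1).
  have := @sum_pow_red_le p a n xs p1 n0; have := max_ge k_ks.
  by rewrite -/S'; nia.
have := all_progressionP (j := S' / M) good; rewrite -S'E => /(_ le_bound).
(* [excluded] also accepts 0 and the non-multiples of p^min(lo, a), so both cases have to be ruled
   out for S'. *)
have S'0 : S' =? 0 = false.
  apply/N.eqb_neq; suff : 0 < S' by lia.
  by apply: sum_pow_gt0 => //; case: (xs) xs0.
have S'd : S' mod p ^ N.min lo a =? 0.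
  apply/N.eqb_eq; apply: sum_pow_dvd => //; rewrite all_map.
  apply/allP => x /(allP lo_xs) /N.leb_le lo_x /=.
  by apply/N.leb_le; apply: red_ge.
rewrite /excluded S'0 S'd /=; case: ifP => [/allP/(_ _ k_ks)|_ S'allowed].
  by rewrite -(size_map (red a n)) fits_sum_pow.
rewrite (sum_pow_red_eq (a := a) (n := n)) //.
by apply/N.ltb_lt; apply: (allP alw).
Qed.

End Check.

(** * Certificates and their verification by computation *)

Definition primes19 : seq N := [:: 2; 3; 5; 7; 11; 13; 17; 19].

(** An entry is (p, q, st), with st the list of moduli and periods used by [check]. Whether the
    table is valid and complete is settled by the next two lemmas. *)
Definition stages : seq (N * N * seq (N * N * N)) := [::
  (2, 3, [:: (6, 2, 16); (6, 24, 15)]);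
  (2, 5, [:: (5, 1, 8); (5, 36, 27)]);
  (2, 7, [:: (6, 1, 8); (6, 36, 27)]);
  (2, 11, [:: (5, 1, 8); (5, 36, 27)]);
  (2, 13, [:: (5, 1, 8); (5, 36, 27)]);
  (2, 17, [:: (7, 36, 72)]);
  (2, 19, [:: (6, 24, 48)]);
  (3, 2, [:: (3, 12, 36)]);
  (3, 5, [:: (3, 12, 72)]);
  (3, 7, [:: (4, 1, 27); (4, 18, 28)]);
  (3, 11, [:: (3, 12, 72)]);
  (3, 13, [:: (3, 12, 72)]);
  (3, 17, [:: (3, 6, 6)]);
  (3, 19, [:: (4, 12, 36)]);
  (5, 2, [:: (2, 6, 60)]);
  (5, 3, [:: (2, 6, 60)]);
  (5, 7, [:: (3, 6, 60)]);
  (5, 11, [:: (3, 1, 50); (3, 12, 12)]);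
  (5, 13, [:: (2, 6, 60)]);
  (5, 17, [:: (2, 5, 20)]);
  (5, 19, [:: (2, 6, 30)]);
  (7, 2, [:: (2, 6, 126)]);
  (7, 3, [:: (2, 1, 42); (2, 12, 60)]);
  (7, 5, [:: (2, 6, 252)]);
  (7, 11, [:: (1, 3, 6)]);
  (7, 13, [:: (2, 7, 182)]);
  (7, 17, [:: (1, 2, 6)]);
  (7, 19, [:: (1, 2, 12); (1, 12, 70)]);
  (11, 2, [:: (1, 4, 60)]);
  (11, 3, [:: (3, 1, 220); (3, 5, 161); (3, 10, 61)]);
  (11, 5, [:: (1, 1, 5); (1, 12, 1116)]);
  (11, 7, [:: (1, 1, 20); (1, 12, 279)]);
  (11, 13, [:: (2, 1, 220); (2, 9, 99)]);
  (11, 17, [:: (1, 1, 20); (1, 12, 279)]);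
  (11, 19, [:: (1, 1, 10)]);
  (13, 2, [:: (1, 2, 12)]);
  (13, 3, [:: (2, 1, 78); (2, 12, 280)]);
  (13, 5, [:: (1, 1, 4)]);
  (13, 7, [:: (1, 1, 12)]);
  (13, 11, [:: (0, 1, 2)]);
  (13, 17, [:: (1, 1, 6)]);
  (13, 19, [:: (1, 1, 12)]);
  (17, 2, [:: (0, 1, 1)]);
  (17, 3, [:: (1, 1, 16)]);
  (17, 5, [:: (1, 1, 16)]);
  (17, 7, [:: (1, 1, 16)]);
  (17, 11, [:: (1, 1, 16)]);
  (17, 13, [:: (1, 1, 4)]);
  (17, 19, [:: (1, 1, 8)]);
  (19, 2, [:: (1, 1, 18)]);
  (19, 3, [:: (1, 1, 18); (1, 6, 98)]);
  (19, 5, [:: (1, 1, 18)]);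
  (19, 7, [:: (1, 1, 3)]);
  (19, 11, [:: (1, 1, 6)]);
  (19, 13, [:: (1, 1, 18)]);
  (19, 17, [:: (0, 1, 2)])].

(** The list [iota 2 7] is 2, ..., 8, the possible numbers t - 1 of powers. Both 7s encode that all
    exponents exceed 6, and the empty list that no sum survives. *)
Lemma stages_check :
  all (fun c => check c.1.1 c.1.2 7 (map N.of_nat (iota 2 7)) [::] c.2 7 1)
    stages.
Proof. by vm_compute. Qed.

Lemma stages_pairs :
  all (fun p =>
    all (fun q => (p == q) || ((p, q) \in [seq c.1 | c <- stages])) primes19)
    primes19.
Proof. by vm_compute. Qed.

Lemma check_5_17 :
  check 5 17 0 [:: 8] [:: 16; 288] [:: (4, 12, 3000); (4, 24, 65)] 0 1.
Proof. by vm_compute. Qed.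

(* Transfer from binary numbers to [nat] *)
Local Close Scope N_scope.

Lemma of_nat_expn m n : N.of_nat (m ^ n) = (N.of_nat m ^ N.of_nat n)%num.
Proof.
elim: n => // n IH.
by rewrite expnS Nat2N.inj_mul IH Nat2N.inj_succ N.pow_succ_r'.
Qed.

Lemma of_nat_sum_expn p (s : seq nat) :
  N.of_nat (\sum_(x <- s) p ^ x) = sum_pow (N.of_nat p) (map N.of_nat s).
Proof.
elim: s => [|x s IH]; first by rewrite big_nil.
by rewrite big_cons Nat2N.inj_add of_nat_expn IH.
Qed.

Lemma mem_primes19 p : prime p -> p <= 19 -> N.of_nat p \in primes19.
Proof. by do 20 (case: p => [//|p]). Qed.

Lemma no_solution p q (s : seq nat) b :
  prime p -> prime q -> p != q -> p <= 19 -> q <= 19 -> 2 <= size s <= 8 ->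
  all (leq 7) s -> 7 <= b -> 1 + \sum_(x <- s) p ^ x <> q ^ b.
Proof.
move=> pp pq neq_pq p19 q19 /andP[s2 s8] s7 b7 eqn.
have := allP stages_pairs _ (mem_primes19 pp p19).
move=> /allP/(_ _ (mem_primes19 pq q19)).
case: eqP => [/Nat2N.inj pqE|_]; first by rewrite pqE eqxx in neq_pq.
rewrite orFb => /mapP[[[P Q] st] mem [PE QE]].
rewrite -{}PE -{}QE in mem.
have chk : check (N.of_nat p) (N.of_nat q) 7 (map N.of_nat (iota 2 7)) [::]
  st 7 1 := allP stages_check _ mem.
suff : sum_pow (N.of_nat p) (map N.of_nat s) \in [::] by rewrite in_nil.
apply: (check_sound (m := N.of_nat (b - 7)) _ chk).
- by move/ltP: (prime_gt1 pp) => ?; lia.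
- rewrite all_map; apply/allP => x /(allP s7)/leP x7.
  by apply/N.leb_le => /=; lia.
- by rewrite size_map map_f // mem_iota s2 ltnS.
- by case: (s) s2.
- rewrite -of_nat_sum_expn -(Nat2N.inj_add 1) plusE eqn of_nat_expn.
  congr (_ ^ _)%num; move/leP: b7; rewrite -minusE; lia.
Qed.

Lemma sum_pow5_17 (s : seq nat) b : size s = 8 ->
  1 + \sum_(x <- s) 5 ^ x = 17 ^ b ->
  (\sum_(x <- s) 5 ^ x = 16 /\ b = 1) \/ (\sum_(x <- s) 5 ^ x = 288 /\ b = 2).
Proof.
move=> sz eqn.
have : sum_pow 5 (map N.of_nat s) \in [:: 16; 288]%num.
  apply: (check_sound (m := N.of_nat b) _ check_5_17) => //.
  - by rewrite all_map; apply/allP => x _; apply/N.leb_le => /=; lia.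
  - by rewrite size_map sz.
  - by case: (s) sz.
  - rewrite -(of_nat_sum_expn 5) -(Nat2N.inj_add 1) plusE eqn of_nat_expn.
    by congr (_ ^ _)%num; lia.
rewrite -(of_nat_sum_expn 5) !inE => /orP[]/eqP sumE; [left | right].
  have {}sumE : \sum_(x <- s) 5 ^ x = 16 by apply: Nat2N.inj; rewrite sumE.
  split=> //; apply/eqP; rewrite -(eqn_exp2l b 1 (_ : 1 < 17)) // -eqn sumE.
  by vm_compute.
have {}sumE : \sum_(x <- s) 5 ^ x = 288 by apply: Nat2N.inj; rewrite sumE.
split=> //; apply/eqP; rewrite -(eqn_exp2l b 2 (_ : 1 < 17)) // -eqn sumE.
by vm_compute.
Qed.

(** * Recovering the exponents from the sums 16 and 288 *)

Fixpoint sorted_seqs (m k n : nat) : seq (seq nat) :=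
  if n is n'.+1 then
    [seq x :: s | x <- iota k (m - k), s <- sorted_seqs m x n']
  else [:: [::]].

Lemma mem_sorted_seqs m k s :
  path leq k s -> all (ltn^~ m) s -> s \in sorted_seqs m k (size s).
Proof.
elim: s k => //= x s IH k /andP[kx px] /andP[xm sm].
apply/allpairsPdep; exists x, s; split; rewrite ?IH //.
by rewrite mem_iota kx subnKC // ltnW // (leq_ltn_trans kx).
Qed.

Lemma sorted_sum_pow5 (s : seq nat) : size s = 8 -> sorted leq s ->
  (\sum_(x <- s) 5 ^ x = 16 -> s = [:: 0; 0; 0; 0; 0; 0; 1; 1]) /\
  (\sum_(x <- s) 5 ^ x = 288 -> s = [:: 0; 0; 0; 1; 1; 2; 3; 3]).
Proof.
move=> sz srt.
have mem_s : \sum_(x <- s) 5 ^ x <= 288 -> s \in sorted_seqs 4 0 8.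
  move=> le_sum; rewrite -sz; apply: mem_sorted_seqs.
    by case: (s) srt.
  apply/allP => x xs; rewrite /= -(ltn_exp2l x 4 (_ : 1 < 5)) //.
  (* Since 288 < 625 = 5^4, every exponent is at most 3. *)
  apply: leq_ltn_trans (_ : 288 < _) => //; apply: leq_trans le_sum.
  by rewrite (big_rem x) //= leq_addr.
(* Only 165 nondecreasing sequences of eight entries below 4 remain to be evaluated. *)
have /allP chk : all (fun s =>
    [&& (sumn (map (expn 5) s) == 16) ==> (s == [:: 0; 0; 0; 0; 0; 0; 1; 1]) &
        (sumn (map (expn 5) s) == 288) ==> (s == [:: 0; 0; 0; 1; 1; 2; 3; 3])])
  (sorted_seqs 4 0 8) by vm_compute.
split=> sumE; move: mem_s; rewrite sumE => /(_ isT)/chk.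
  by rewrite sumnE big_map sumE => /andP[/eqP].
by rewrite sumnE big_map sumE => /andP[_ /eqP].
Qed.

(* Exponents alpha_1, ..., alpha_t are a i for 1 <= i <= t.
   The equation 1 + p^a1 + ... + p^a(t-1) - q^at = 0 is written in nat
   as 1 + sum = q^at (no truncation issue). *)
Theorem theorem5 :
  (forall (t p q : nat) (a : nat -> nat),
      3 <= t <= 9 -> prime p -> prime q -> p != q -> p <= 19 -> q <= 19 ->
      1 + \sum_(1 <= i < t) p ^ a i = q ^ a t ->
      exists2 i, 1 <= i <= t & a i <= 6)
  /\
  (forall a : nat -> nat,
      (1 + \sum_(1 <= i < 9) 5 ^ a i = 17 ^ a 9 /\
       (forall i, 1 <= i < 8 -> a i <= a i.+1))
      <->
      ([seq a i | i <- iota 1 9] = [:: 0; 0; 0; 0; 0; 0; 1; 1; 1] \/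
       [seq a i | i <- iota 1 9] = [:: 0; 0; 0; 1; 1; 2; 3; 3; 2])).
Proof.
split=> [t p q a /andP[t3 t9] pp pq neq_pq p19 q19 eqn | a].
  case: (boolP (has (fun i => a i <= 6) (index_iota 1 t.+1)))
      => [/hasP[i]|/hasPn a7].
    by rewrite mem_index_iota ltnS => it ai; exists i.
  (* With no exponent at most 6, all are at least 7, including that of q, since the range searched
     ends at t. *)
  case: (@no_solution p q (map a (index_iota 1 t)) (a t)) => //.
  - rewrite size_map size_iota; case: (t) t3 t9 => // u u2 u8.
    by rewrite subn1; apply/andP; split.
  - rewrite all_map; apply/allP => i; rewrite mem_index_iota => /andP[i1 it] /=.
    by rewrite ltnNge a7 // mem_index_iota i1 ltnS ltnW.
  - by rewrite ltnNge a7 // mem_index_iota ltnS leqnn (leq_trans _ t3).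
  by rewrite big_map.
have E : map a (iota 1 9) = rcons (map a (iota 1 8)) (a 9) by [].
split=> [[eqn a_le]|].
  have sz : size (map a (iota 1 8)) = 8 by rewrite size_map size_iota.
  have srt : sorted leq (map a (iota 1 8)) by rewrite /= !a_le.
  have [sum16 sum288] := sorted_sum_pow5 sz srt.
  rewrite E; case: (@sum_pow5_17 (map a (iota 1 8)) (a 9) sz).
  - by rewrite big_map.
  - by case=> /sum16-> ->; left.
  - by case=> /sum288-> ->; right.
rewrite /=; case=> -[a1 a2 a3 a4 a5 a6 a7 a8 a9]; split.
- by rewrite unlock /= a1 a2 a3 a4 a5 a6 a7 a8 a9.
- case=> [|[|[|[|[|[|[|[|i]]]]]]]] // _;
    by rewrite ?(a1, a2, a3, a4, a5, a6, a7, a8).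
- by rewrite unlock /= a1 a2 a3 a4 a5 a6 a7 a8 a9.
- case=> [|[|[|[|[|[|[|[|i]]]]]]]] // _;
    by rewrite ?(a1, a2, a3, a4, a5, a6, a7, a8).
Qed.
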